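(* Assume that $\lambda'(t)\le 0$ for almost every $t\ge 0$ and that there exist $\kappa>0$ and $\theta\in(0,\tfrac12]$ such that $$\big(f(x)-f_Q^*\big)^{\theta}\ \ge\ \kappa\,\mathrm{dist}\big(x,\arg\min_Q f\big)\qquad\text{for all }x\in Q.$$ Let $x_0\in Q$ and let $x$ be the unique solution in $C^1([0,+\infty),\mathcal{H})$ of $$x'(t)+x(t)=P_Q\big(x(t)-\lambda(t)\nabla f(x(t))\big),\quad t\ge 0,\qquad x(0)=x_0.$$ Let $\Gamma(t)=\int_0^t\lambda(s)\,ds$. (1) If $\theta\in(0,\tfrac12)$ and $$\int_1^{+\infty}\frac{1}{1+t}\,\big(\Gamma(t)\big)^{-\frac{\theta}{1-2\theta}}\,dt<\infty,$$ then $x(t)$ converges strongly as $t\to+\infty$ to some $x_\infty\in\arg\min_Q f$, and, as $t\to+\infty$, $$\|x(t)-x_\infty\|=O\left(\int_t^{+\infty}\frac1s\big(\Gamma(s)\big)^{-\frac{\theta}{1-2\theta}}ds\right),\qquad f(x(t))-f_Q^*=O\left(\frac{(\Gamma(t))^{-\frac{2\theta}{1-2\theta}}}{t\,\lambda(t)}\right).$$ (2) If $\theta=\tfrac12$ and for every $c>0$ $$\int_0^{+\infty}\frac{1}{1+t}\,e^{-c\,\Gamma(t)}\,dt<\infty,$$ then $x(t)$ converges strongly as $t\to+\infty$ to some $x_\infty\in\arg\min_Q f$, and there exists $\mu>0$ such that, as $t\to+\infty$, $$\|x(t)-x_\infty\|=O\big(e^{-\mu\Gamma(t)}\big),\qquad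 f(x(t))-f_Q^*=O\big(e^{-\mu\Gamma(t)}\big).$$
   Context: $\mathcal{H}$ is a real Hilbert space with inner product $\langle\cdot,\cdot\rangle$ and norm $\|\cdot\|$. $Q$ is a closed, convex, non-empty subset of $\mathcal{H}$, and $P_Q:\mathcal{H}\to Q$ is the (metric) projection onto $Q$. $\lambda:[0,+\infty)\to(0,+\infty)$ is an absolutely continuous function belonging to $W^{1,1}_{loc}([0,+\infty))$ (that is, absolutely continuous on each $[0,T]$). $f:\mathcal{H}\to\mathbb{R}$ is a $C^1$ convex function whose gradient $\nabla f$ is locally Lipschitz on $\mathcal{H}$. It is assumed that $f$ attains its minimum over $Q$: with $f_Q^*:=\min_Q f$, the set $\arg\min_Q f:=\{x\in Q: f(x)=f_Q^*\}$ is non-empty. $\mathrm{dist}(x,S)=\inf_{y\in S}\|x-y\|$. Under these standing assumptions, for every $x_0\in Q$ the Cauchy problem $x'(t)+x(t)=P_Q\big(x(t)-\lambda(t)\nabla f(x(t))\big)$, $t\ge 0$, $x(0)=x_0$, has a unique global solution $x\in C^1([0,+\infty),\mathcal{H})$, and it stays in $Q$. *)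

(* Defs.v *)
From HB Require Import structures.
From mathcomp Require Import all_boot all_order all_algebra.
From mathcomp Require Import all_classical all_reals all_analysis.

Set Implicit Arguments.
Unset Strict Implicit.
Unset Printing Implicit Defensive.

Import Order.TTheory GRing.Theory Num.Theory.
Import numFieldNormedType.Exports.

Local Open Scope classical_set_scope.
Local Open Scope ring_scope.

(* Lets Landau notations be used at +oo. *)
Canonical pinfty_nbhs_filter_on (R : numFieldType) :=
  FilterType (pinfty_nbhs R) _.

(* A real Hilbert space is a complete normed module H together with a dot
   product satisfying [hilbert_norm]. *)
Definition hilbert_norm (R : realType) (H : completeNormedModType R)
    (ip : {dot H for idfun}) : Prop :=
  forall u : H, ip u u = `|u| ^+ 2.

Definition is_metric_projection (R : realType) (H : normedModType R)
    (Q : set H) (P : H -> H) : Prop :=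
  forall x, Q (P x) /\ forall y, Q y -> `|x - P x| <= `|x - y|.

(* [differentiable] is Frechet differentiability, with continuous differential. *)
Definition is_gradient (R : realType) (H : completeNormedModType R)
    (ip : {dot H for idfun}) (f : H -> R) (gradf : H -> H) : Prop :=
  forall x, differentiable f x /\ forall v, 'd f x v = ip (gradf x) v.

Definition locally_lipschitz (R : realType) (V W : normedModType R)
    (g : V -> W) : Prop :=
  forall x : V, exists2 U, nbhs x U & [lipschitz g y | y in U].

(* The minimum is a separate argument m, rather than [inf (f @` Q)], because
   the real-valued [inf] is 0 on sets that are unbounded below. *)
Definition is_min_on (R : realType) (T : Type) (f : T -> R) (Q : set T)
    (m : R) : Prop :=
  (exists2 x, Q x & f x = m) /\ forall x, Q x -> m <= f x.

Definition argmin_on (R : realType) (T : Type) (f : T -> R) (Q : set T)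
    (m : R) : set T :=
  [set x | Q x /\ f x = m].

Definition dist (R : realType) (V : normedModType R) (x : V) (S : set V) : R :=
  inf [set `|x - y| | y in S].

(* Degenerate intervals (a i = b i) are allowed; they contribute 0. *)
Definition abs_continuous_on (R : realType) (c d : R) (g : R -> R) : Prop :=
  forall e : R, 0 < e -> exists2 delta, 0 < delta &
    forall (n : nat) (a b : 'I_n -> R),
      (forall i, [/\ c <= a i, a i <= b i & b i <= d]) ->
      trivIset setT (fun i => `]a i, b i[%classic) ->
      \sum_i (b i - a i) < delta ->
      \sum_i `|g (b i) - g (a i)| < e.

(* Derivative relative to D: one-sided at the points of D that are endpoints
   of the interval D. *)
Definition has_derivative_in (R : realType) (V : normedModType R) (D : set R)
    (x : R -> V) (t : R) (v : V) : Prop :=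
  (fun s => (s - t)^-1 *: (x s - x t)) @ within D t^' --> v.

(* x is only constrained on [0, +oo[; its values elsewhere are irrelevant. *)
Definition is_C1_solution (R : realType) (H : normedModType R)
    (P : H -> H) (lambda : R -> R) (gradf : H -> H) (x0 : H) (x : R -> H)
    : Prop :=
  exists x' : R -> H,
    [/\ forall t : R, 0 <= t -> has_derivative_in `[0, +oo[ x t (x' t),
        {within `[0, +oo[, continuous x'},
        forall t : R, 0 <= t -> x' t + x t = P (x t - lambda t *: gradf (x t))
      & x 0 = x0].

Definition Gamma (R : realType) (lambda : R -> R) (t : R) : R :=
  \int[@lebesgue_measure R]_(s in `[0, t]) lambda s.

(* Main.v *)
(* Write E(t) = f(x(t)) - min_Q f.  The variational inequality of the projection
   shows that E is nonincreasing and that, for every minimizer z,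
   |x - z|^2 / 2 + lambda E decreases at rate at least lambda E, hence
     |x(t) - z|^2 / 2 + (Gamma(t) - Gamma(s)) E(t)
       <= |x(s) - z|^2 / 2 + lambda(s) E(s).
   For z nearly closest to x(s) the growth condition bounds the right-hand side
   by C E(s)^(2 theta).  This single inequality gives both
     E(t) (Gamma(t) - Gamma(s)) <= C E(s)^(2 theta) and
     |x(t) - x(s)| <= D E(s)^theta for s <= t.
   Iterating the first one along times at which Gamma is halved
   (theta < 1/2), or decreased by 2 C (theta = 1/2), gives the decay of E in
   terms of Gamma; the integral condition forces Gamma -> +oo, so x is Cauchy,
   with |x(t) - x_oo| <= D E(t)^theta.  The integral in the stated rate is at
   least a multiple of Gamma(t)^(- theta / (1 - 2 theta)), by its part over
   [t, 2t] and the concavity of Gamma.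
   As lambda is only absolutely continuous, derivatives are replaced by
   estimates on short intervals around each point, chained by Cousin's lemma. *)
Require Import Defs.
From HB Require Import structures.
From mathcomp Require Import all_boot all_order all_algebra.
From mathcomp Require Import all_classical all_reals all_analysis.
From mathcomp Require Import measurable_realfun lra ring.

Set Implicit Arguments.
Unset Strict Implicit.
Unset Printing Implicit Defensive.

Import Order.TTheory GRing.Theory Num.Theory.
Import numFieldNormedType.Exports.

Local Open Scope classical_set_scope.
Local Open Scope ring_scope.

(** * Intervals straddling a point *)

(** Difference quotients over intervals containing [t] tend to the derivative at [t] without any
    continuity of the derivative, and such tagged intervals are the ones that Cousin's lemma chains.
    If [t] is an endpoint of an interval [D], it is itself one of the two ends. *)
Definition straddle (R : realType) (D : set R) (t : R) : set_system (R * R) :=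
  within [set uv | [/\ D uv.1, D uv.2, uv.1 <= t <= uv.2 & uv.1 < uv.2]]
    (nbhs (t, t)).

#[export] Instance straddle_filter (R : realType) (D : set R) (t : R) :
  Filter (straddle D t).
Proof. exact: within_filter. Qed.

Lemma near_straddleP (R : realType) (D : set R) (t : R) (p : R * R -> Prop) :
  (\forall uv \near straddle D t, p uv) <->
  exists2 d : R, 0 < d & forall u v, D u -> D v -> u <= t -> t <= v -> u < v ->
    t - d < u -> v < t + d -> p (u, v).
Proof.
rewrite near_withinE; split=> [/nbhs_ballP[d /= d0 h]|[d d0 h]].
  exists d => // u v Du Dv ut tv uv tu vt; apply: h => /=; last by split=> //; lra.
  by split; rewrite /ball/= ?ltr_norml; lra.
apply/nbhs_ballP; exists d => //= -[u v] [/=]; rewrite /ball/= !ltr_norml.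
by move=> tu tv [/= Du Dv] /andP[ut vt] uv; apply: h => //; lra.
Qed.

(** Let c be the supremum of the points reachable from [a]. A straddling interval at c can start at
    a reachable point and end beyond c, which is absurd unless c is [b]. *)
Lemma cousin (R : realType) (D : set R) (p : R -> R -> Prop) (a b : R) :
  a < b -> `[a, b] `<=` D ->
  (forall u v w, a <= u -> u < v -> v < w -> w <= b ->
    p u v -> p v w -> p u w) ->
  (forall t, a <= t <= b -> \forall uv \near straddle D t, p uv.1 uv.2) ->
  p a b.
Proof.
move=> ab abD ptr ploc; have le_ab := ltW ab.
(* The guard [a < t] puts [a] in [A] although [p a a] is not known. *)
pose A := [set t | a <= t <= b /\ (a < t -> p a t)].
have Aa : A a by split; [rewrite lexx le_ab|rewrite ltxx].
have supA : has_sup A.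
  by split; [exists a | exists b => t [/andP[]]].
have ac : a <= sup A by exact: (ub_le_sup supA.2).
have cb : sup A <= b.
  by apply: ge_sup; [exists a|move=> t [/andP[]]].
have cab : a <= sup A <= b by rewrite ac cb.
have /near_straddleP[d d0 hd] := ploc _ cab.
have [s [/andP[sa sb] ps] hs] := sup_adherent d0 supA.
have sc : s <= sup A by apply: (ub_le_sup supA.2); split; [rewrite sa sb|].
have key v : s < v -> sup A <= v -> v < sup A + d -> v <= b -> p a v.
  move=> sv cv vd vb.
  have psv : p s v.
    by apply: (hd s v) => //; apply: abD; rewrite /= in_itv/=; apply/andP; split; lra.
  have [->//|/eqP sNa] := eqVneq a s.
  have as' : a < s by rewrite lt_neqAle sa andbT; apply/eqP.
  exact: (ptr _ s) (ps _) _.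
pose v := Num.min b (sup A + d / 2).
have vb : v <= b by rewrite ge_min lexx.
have cv : sup A <= v by rewrite le_min cb/=; lra.
have vd : v < sup A + d.
  by apply: (@le_lt_trans _ _ (sup A + d / 2)); [rewrite ge_min lexx orbT|lra].
have Av : A v.
  split; first by rewrite vb (le_trans ac cv).
  move=> av; have [sv|vs] := ltP s v; first exact: key.
  by have <- : s = v by [apply/eqP; rewrite eq_le vs (le_trans sc)]; apply: ps; lra.
have vc : v <= sup A by exact: (ub_le_sup supA.2).
have vE : v = b.
  by move: vc; rewrite /v; case: (leP b (sup A + d / 2)) => //; lra.
by rewrite -vE; apply: Av.2; rewrite vE.
Qed.

(** Chaining increments of slope [e / (b - a)] costs [e] in total, and [e] is arbitrary. The side
    conditions on [uv] discard straddling intervals that leave [a, b]. *)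
Lemma straddle_le (R : realType) (D : set R) (g : R -> R) (a b : R) :
  a <= b -> `[a, b] `<=` D ->
  (forall t, a <= t <= b -> forall e : R, 0 < e -> \forall uv \near straddle D t,
    a <= uv.1 -> uv.2 <= b -> g uv.2 <= g uv.1 + e * (uv.2 - uv.1)) ->
  g b <= g a.
Proof.
rewrite le_eqVlt => /predU1P[->//|ab] abD h; apply/ler_addgt0Pr => e e0.
have := @cousin R D (fun u v => a <= u -> v <= b -> g v <= g u + e / (b - a) * (v - u))
  a b ab abD.
rewrite divfK ?subr_eq0 ?gt_eqF//; apply => //.
- move=> u v w au uv vw wb h1 h2 _ _.
  have {}h1 := h1 au (le_trans (ltW vw) wb).
  have {}h2 := h2 (le_trans au (ltW uv)) wb.
  apply: (le_trans h2); rewrite -lerBrDr; apply: (le_trans h1); lra.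
- by move=> t /h; apply; rewrite divr_gt0// subr_gt0.
Qed.

(** The exceptional null set lies in an open [G] of measure below the modulus [d]. Near its points
    growth is charged to absolute continuity; near all other points it is at most a slope [c], which
    adds up to [e / 2]. *)
Lemma abs_continuous_le (R : realType) (F : R -> R) (a b : R) :
  a <= b -> abs_continuous_on a b F ->
  {ae @lebesgue_measure R, forall t : R, a <= t <= b ->
     derivable F t 1 /\ F^`()%classic t <= 0} ->
  F b <= F a.
Proof.
rewrite le_eqVlt => /predU1P[->//|ab] Fac [N [mN N0 hN]].
apply/ler_addgt0Pr => e e0; have e20 : 0 < e / 2 by rewrite divr_gt0.
have [d d0 hd] := Fac _ e20.
have [|G [oG NG Gd]] := lebesgue_regularity_outer mN _ d0.
  by rewrite [X in (X < _)%E]N0.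
have mG : measurable G by exact: open_measurable.
have Gd' : (lebesgue_measure G < d%:E)%E.
  rewrite -(setDUK NG); apply: le_lt_trans (measureU2 _ _ _) _ => //.
    exact: measurableD.
  by rewrite -[X in (X + _)%E]/(lebesgue_measure N) N0 add0e.
pose c := e / 2 / (b - a).
have c0 : 0 < c by rewrite divr_gt0// subr_gt0.
(* The intervals charged to [G] are carried along as a disjoint family, so that absolute continuity
   is applied once, to the whole family over [a, b]; applied piecewise, the errors would not add up
   to a small one. *)
pose p u v := exists (n : nat) (l r : 'I_n -> R),
  [/\ forall i, [/\ u <= l i, l i <= r i & r i <= v],
      forall i, `]l i, r i[ `<=` G,
      trivIset setT (fun i => `]l i, r i[%classic) &
      F v - F u <= c * (v - u) + \sum_i `|F (r i) - F (l i)|].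
have : p a b.
  apply: (@cousin R setT) => //.
  - move=> u v w au uv vw wb [n [l [r [h1 h2 h3 h4]]]].
    move=> [m [l' [r' [k1 k2 k3 k4]]]].
    exists (n + m)%N.
    exists (fun i : 'I_(n + m) =>
      match fintype.split i with inl j => l j | inr j => l' j end).
    exists (fun i : 'I_(n + m) =>
      match fintype.split i with inl j => r j | inr j => r' j end).
    split.
    + move=> i; case: (fintype.split i) => j.
        by have [? ? ?] := h1 j; split=> //; lra.
      by have [? ? ?] := k1 j; split=> //; lra.
    + by move=> i; case: (fintype.split i).
    + move=> i j _ _; rewrite -(splitK i) -(splitK j) !unsplitK.
      case: (fintype.split i) => i'; case: (fintype.split j) => j' /= [y].
      * by move=> h; congr (lshift _ _); apply: h3 => //; exists y.
      * rewrite /= !in_itv/=; have [_ _ ?] := h1 i'; have [? _ _] := k1 j'.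
        by move=> [/andP[_ ?] /andP[? _]]; exfalso; lra.
      * rewrite /= !in_itv/=; have [_ _ ?] := h1 j'; have [? _ _] := k1 i'.
        by move=> [/andP[? _] /andP[_ ?]]; exfalso; lra.
      * by move=> h; congr (rshift _ _); apply: k3 => //; exists y.
    + rewrite big_split_ord/=.
      rewrite (eq_bigr (fun i => `|F (r i) - F (l i)|)); last first.
        by move=> i _; rewrite (unsplitK (inl i)).
      rewrite [X in _ + (_ + X)](eq_bigr (fun i => `|F (r' i) - F (l' i)|)).
        by move: h4 k4; lra.
      by move=> i _; rewrite (unsplitK (inr i)).
  - move=> t tab; have [Nt|Nt] := pselect (N t).
      have /nbhs_ballP[r /= r0 rG] : nbhs t G.
        by apply: open_nbhs_nbhs; split => //; exact: NG.
      apply/near_straddleP; exists r => //= u v _ _ ut tv uv tru vtr.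
      exists 1%N, (fun=> u), (fun=> v); split=> //.
      + by move=> _; split=> //; exact: ltW.
      + move=> _ y /=; rewrite in_itv/= => /andP[uy yv].
        by apply: rG; rewrite /ball/= ltr_norml; lra.
      + by move=> i j _ _ _; rewrite !ord1.
      + rewrite big_ord_recl big_ord0 addr0.
        apply: (le_trans (ler_norm _)); rewrite lerDr mulr_ge0//; [exact: ltW|lra].
    have [dF F0] : derivable F t 1 /\ F^`()%classic t <= 0.
      by apply: contrapT => h; apply: Nt; apply: hN => /= k; exact: h (k tab).
    have : \forall h \near (0 : R)^', h^-1 * (F (h + t) - F t) < c.
      have : (fun h : R => h^-1 *: (F (h *: 1 + t) - F t)) h @[h --> 0^'] -->
          F^`()%classic t.
        by rewrite derive1E; exact: dF.
      move=> /cvgr_lt /(_ c (le_lt_trans F0 c0)).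
      by apply: filterS => h /=; rewrite [h *: 1]mulr1.
    rewrite near_withinE => /nbhs_ballP[r /= r0 hr].
    apply/near_straddleP; exists r => //= u v _ _ ut tv uv tru vtr.
    exists 0%N, (fun=> 0), (fun=> 0); split=> //; try by case.
    rewrite big_ord0 addr0.
    have h1 : F v - F t <= c * (v - t).
      move: tv; rewrite le_eqVlt => /predU1P[->|tv]; first by rewrite !subrr mulr0.
      have := hr (v - t); rewrite /ball/= sub0r normrN subrK => h.
      have {}h : (v - t)^-1 * (F v - F t) < c.
        by apply: h; [rewrite ltr_norml; lra|rewrite subr_eq0 gt_eqF].
      by move: h; rewrite mulrC ltr_pdivrMr ?subr_gt0//; exact: ltW.
    have h2 : F t - F u <= c * (t - u).
      move: ut; rewrite le_eqVlt => /predU1P[->|ut]; first by rewrite !subrr mulr0.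
      have := hr (u - t); rewrite /ball/= sub0r normrN subrK => h.
      have {}h : (u - t)^-1 * (F u - F t) < c.
        by apply: h; [rewrite ltr_norml; lra|rewrite subr_eq0 lt_eqF].
      move: h; rewrite -mulrNN -invrN !opprB mulrC ltr_pdivrMr ?subr_gt0//.
      exact: ltW.
    by move: h1 h2; lra.
move=> [n [l [r [h1 h2 h3 h4]]]].
(* Disjoint intervals inside [G] have total length at most the measure of [G], hence below [d]. *)
have hs : \sum_i `|F (r i) - F (l i)| < e / 2.
  apply: hd => //; rewrite -lte_fin; apply: le_lt_trans Gd'.
  rewrite -sumEFin.
  have -> : (\sum_(i < n) (r i - l i)%:E =
             \sum_(i < n) lebesgue_measure `]l i, r i[%classic)%E.
    apply: eq_bigr => i _; rewrite lebesgue_measure_itv/= lte_fin.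
    case: ltP => [_|rl]; first by rewrite EFinB.
    by have [_ lr _] := h1 i; rewrite (_ : r i = l i) ?subrr//; lra.
  rewrite -measure_bigsetU_ord//.
  apply: le_measure; rewrite ?inE//.
    by apply: bigsetU_measurable => i _; exact: measurable_itv.
  by rewrite -bigcup_seq => y [i _]; exact: h2.
have : c * (b - a) = e / 2 by rewrite /c divfK// subr_eq0 gt_eqF.
by move: h4 hs; lra.
Qed.

(** * Limits and derivatives along straddling intervals *)

Lemma cvg_straddle_fst (R : realType) (D : set R) (t : R) :
  uv.1 @[uv --> straddle D t] --> within D (nbhs t).
Proof.
move=> A; rewrite /= /nbhs/= => /nbhs_ballP[d /= d0 h].
apply/near_straddleP; exists d => //= u v Du Dv ut tv uv tu vt.
by apply: h => //; rewrite /ball/= ltr_norml; lra.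
Qed.

Lemma cvg_straddle_snd (R : realType) (D : set R) (t : R) :
  uv.2 @[uv --> straddle D t] --> within D (nbhs t).
Proof.
move=> A; rewrite /= /nbhs/= => /nbhs_ballP[d /= d0 h].
apply/near_straddleP; exists d => //= u v Du Dv ut tv uv tu vt.
by apply: h => //; rewrite /ball/= ltr_norml; lra.
Qed.

Section relative_derivative.
Context {R : realType} {V : normedModType R}.
Implicit Types (D : set R) (x : R -> V) (t : R) (d : V).

Lemma has_derivative_in_le D x t d : has_derivative_in D x t d ->
  forall e, 0 < e -> \forall s \near within D (nbhs t),
    `|x s - x t - (s - t) *: d| <= e * `|s - t|.
Proof.
move=> /cvgrPdist_le h e e0; have := h e e0.
rewrite !near_withinE; apply: filterS => s hs Ds.
have [->|st] := eqVneq s t; first by rewrite !subrr scale0r subr0 !normr0 mulr0.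
have st0 : s - t != 0 by rewrite subr_eq0.
rewrite -{1}[x s - x t](scalerKV st0) -scalerBr normrZ mulrC distrC.
by rewrite ler_wpM2r//; exact: hs.
Qed.

Lemma has_derivative_in_cvg D x t d : has_derivative_in D x t d ->
  x s @[s --> within D (nbhs t)] --> x t.
Proof.
move=> /has_derivative_in_le/(_ 1 ltr01) h.
suff : (x t + (s - t) *: d + (x s - x t - (s - t) *: d))
    @[s --> within D (nbhs t)] --> x t + (t - t) *: d + 0.
  rewrite subrr scale0r !addr0; apply: cvg_trans; apply: near_eq_cvg.
  by apply: nearW => s; rewrite addrC [x t + _]addrC addrA subrK subrK.
have cid : (s - t) @[s --> within D (nbhs t)] --> t - t.
  by apply: cvg_within_filter; apply: cvgB; [exact: cvg_id|exact: cvg_cst].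
apply: cvgD; first by apply: cvgD; [exact: cvg_cst|exact: cvgZr_tmp].
apply/norm_cvg0P; apply: (@squeeze_cvgr _ _ _ _ (fun=> 0) (fun s => 1 * `|s - t|)).
- by move: h; apply: filterS => s; rewrite normr_ge0.
- exact: cvg_cst.
- under eq_fun do rewrite mul1r.
  by rewrite -(normr0 R) -(subrr t); exact: cvg_norm.
Qed.

(** The linearization error over (u, v) is the difference of those at v and u. Since t lies between
    them, it is at most e (v - t) + e (t - u) = e (v - u). *)
Lemma has_derivative_in_straddle D x t d : has_derivative_in D x t d ->
  ((uv.2 - uv.1)^-1 *: (x uv.2 - x uv.1)) @[uv --> straddle D t] --> d.
Proof.
move=> h; apply/cvgrPdist_le => e e0.
have he := has_derivative_in_le h e0.
have h1 : \forall uv \near straddle D t,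
    `|x uv.1 - x t - (uv.1 - t) *: d| <= e * `|uv.1 - t| := cvg_straddle_fst he.
have h2 : \forall uv \near straddle D t,
    `|x uv.2 - x t - (uv.2 - t) *: d| <= e * `|uv.2 - t| := cvg_straddle_snd he.
have : \forall uv \near straddle D t, uv.1 <= t <= uv.2 /\ uv.1 < uv.2.
  by apply/near_straddleP; exists 1 => // u v _ _ ut tv uv _ _ /=; rewrite ut tv uv.
move: h1 h2; apply: filterS3 => -[u v] /= h1 h2 [/andP[ut tv] uv].
have vu : 0 < v - u by rewrite subr_gt0.
rewrite -(ler_pM2l vu) -[X in X * `|_|](gtr0_norm vu) -normrZ scalerBr.
rewrite scalerKV ?gt_eqF// distrC.
have -> : x v - x u - (v - u) *: d =
    (x v - x t - (v - t) *: d) - (x u - x t - (u - t) *: d).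
  rewrite (_ : v - u = (v - t) - (u - t)); last by ring.
  rewrite [in RHS]opprD opprK [RHS]addrACA (opprB (x u)) [X in _ = X + _]addrA subrK.
  by rewrite [in LHS]scalerBl opprB [- _ + _]addrC.
apply: (le_trans (ler_normB _ _)); apply: (le_trans (lerD h2 h1)).
rewrite ger0_norm ?subr_ge0// ler0_norm ?subr_le0//.
lra.
Qed.

End relative_derivative.

(** * Inner product, projection onto a convex set, and gradient inequality *)

Section hilbert.
Context {R : realType} {H : completeNormedModType R} (ip : {dot H for idfun}).
Hypothesis ipE : hilbert_norm ip.

Lemma ipC u v : ip u v = ip v u.
Proof. by rewrite hermC expr0 mul1r. Qed.

Lemma ipDr u v w : ip u (v + w) = ip u v + ip u w.
Proof. exact: linearDr. Qed.

Lemma ipNr u v : ip u (- v) = - ip u v.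
Proof. exact: linearNr. Qed.

Lemma ipZr u v (s : R) : ip u (s *: v) = s * ip u v.
Proof. exact: linearZr_LR. Qed.

Lemma ipDl u v w : ip (u + v) w = ip u w + ip v w.
Proof. by rewrite !(ipC _ w) ipDr. Qed.

Lemma ipNl u v : ip (- u) v = - ip u v.
Proof. by rewrite !(ipC _ v) ipNr. Qed.

Lemma ipZl u v (s : R) : ip (s *: u) v = s * ip u v.
Proof. by rewrite !(ipC _ v) ipZr. Qed.

(** Reduces the continuity of [ip] to that of the norm, in [cvg_ip]. *)
Lemma ip_polarization u v : ip u v = 4^-1 * (`|u + v| ^+ 2 - `|u - v| ^+ 2).
Proof.
rewrite -!ipE !(ipDl, ipDr, ipNl, ipNr) (ipC v u).
by field.
Qed.

Lemma cvg_ip T (F : set_system T) {FF : Filter F} (g h : T -> H) (a b : H) :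
  g y @[y --> F] --> a -> h y @[y --> F] --> b ->
  ip (g y) (h y) @[y --> F] --> ip a b.
Proof.
move=> ga hb; under eq_fun do rewrite ip_polarization.
rewrite ip_polarization; apply: cvgMl_tmp; apply: cvgB; rewrite expr2;
  under eq_fun do rewrite expr2.
  by apply: cvgM; apply: cvg_norm; exact: cvgD.
by apply: cvgM; apply: cvg_norm; exact: cvgB.
Qed.

(** The two sides differ by half of |u - v|^2. This replaces the derivative of the squared distance
    in the energy estimate. *)
Lemma ip_half_sqr u v : `|u| ^+ 2 / 2 - `|v| ^+ 2 / 2 <= ip u (u - v).
Proof.
have : 0 <= `|u - v| ^+ 2 by rewrite sqr_ge0.
rewrite -!ipE !(ipDl, ipDr, ipNl, ipNr) (ipC v u); lra.
Qed.

Lemma sqr_normBZ u v (s : R) :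
  `|u - s *: v| ^+ 2 = `|u| ^+ 2 - 2 * s * ip u v + s ^+ 2 * `|v| ^+ 2.
Proof.
rewrite -!ipE !(ipDl, ipDr, ipNl, ipNr, ipZl, ipZr) (ipC v u).
by ring.
Qed.

Variables (Q : set H) (P : H -> H).
Hypotheses (cQ : convex_set Q) (PQ : is_metric_projection Q P).

Lemma convex_set_combination (u v : H) (s : R) : 0 <= s -> s <= 1 -> Q u -> Q v ->
  Q (s *: u + (1 - s) *: v).
Proof.
move=> s0 s1 Qu Qv.
by have := cQ (Itv01 s0 s1) (mem_set Qu) (mem_set Qv); rewrite inE.
Qed.

(** Otherwise a small move from [P w] towards [y], which stays in [Q] by convexity, would come
    closer to [w]. *)
Lemma metric_projection_le (w y : H) : Q y -> ip (w - P w) (y - P w) <= 0.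
Proof.
move=> Qy; set p := P w; set a := ip _ _.
have [//|a0] := leP a 0.
have n0 : 0 <= `|y - p| ^+ 2 by rewrite sqr_ge0.
(* Minimality of [p] will give 2 a <= s |y - p|^2. The summand [a] in the denominator keeps [s] at
   most 1 and makes s |y - p|^2 at most [a], a contradiction. *)
pose s := a / (`|y - p| ^+ 2 + a).
have d0 : 0 < `|y - p| ^+ 2 + a by rewrite ltr_wpDl.
have s0 : 0 < s by rewrite divr_gt0.
have s1 : s <= 1 by rewrite ler_pdivrMr// mul1r lerDr.
have Qp : Q p by exact: (PQ w).1.
have := (PQ w).2 _ (convex_set_combination (ltW s0) s1 Qy Qp).
rewrite -/p -(ler_pXn2r (ltn0Sn 1)) ?nnegrE//.
have -> : w - (s *: y + (1 - s) *: p) = (w - p) - s *: (y - p).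
  by rewrite scalerBl scale1r scalerBr addrCA opprD addrA.
rewrite sqr_normBZ -/a => h.
have {}h : 2 * a <= s * `|y - p| ^+ 2.
  by rewrite -(ler_pM2l s0); move: h; rewrite expr2; lra.
have sn : s * `|y - p| ^+ 2 <= a.
  rewrite /s mulrAC ler_pdivrMr// ler_pM2l// lerDl; exact: ltW.
move: (le_trans h sn); lra.
Qed.

End hilbert.

(** By convexity every difference quotient of [f] from [y] towards [z], with step in ]0, 1], is at
    most [f z - f y]; so is its limit. *)
Lemma convex_gradient_le (R : realType) (H : completeNormedModType R)
    (ip : {dot H for idfun}) (f : H -> R) (gradf : H -> H) (y z : H) :
  convex_function setT f -> is_gradient ip f gradf ->
  f y + ip (gradf y) (z - y) <= f z.
Proof.
move=> cf gf; have [df dfE] := gf y.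
rewrite -dfE -deriveE// leNgt; apply/negP => lt.
have {}lt : f z - f y < 'D_(z - y) f y by rewrite ltrBlDl.
have := diff_derivable (v := z - y) df.
move=> /cvgr_gt /(_ _ lt); rewrite near_withinE => /nbhs_ballP[r /= r0 hr].
pose h := Num.min 1 (r / 2).
have h0 : 0 < h by rewrite lt_min ltr01/= divr_gt0.
have h1 : h <= 1 by rewrite ge_min lexx.
have hr2 : h < r by apply: (@le_lt_trans _ _ (r / 2)); [rewrite ge_min lexx orbT|lra].
have := hr h; rewrite /ball/= sub0r normrN gtr0_norm// gt_eqF// => /(_ hr2 isT).
rewrite ltNge => /negP; apply.
have {}cf : f (h *: (z - y) + y) <= h * f z + (1 - h) * f y.
  have <- : h *: z + (1 - h) *: y = h *: (z - y) + y.
    by rewrite scalerBl scale1r scalerBr addrA addrAC.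
  exact: (cf (Itv01 (ltW h0) h1) z y (mem_set I) (mem_set I)).
by rewrite /GRing.scale/= mulrC ler_pdivrMr//; move: cf; lra.
Qed.

(** * The projected gradient flow *)

(** Used with [a = x u], [w] the difference quotient over [u, v], [d + b = x' r + x r] and
    [q = P (x u)]: the first term is the old gap to [Q], contracted, and the second is o(s). *)
Lemma convex_combination_error (R : realType) (V : lmodType R) (s : R)
    (a w d b q : V) :
  a + s *: w - (s *: (d + b) + (1 - s) *: q) =
  (1 - s) *: (a - q) + s *: ((w - d) + (a - b)).
Proof.
have -> : (w - d) + (a - b) = (w - (d + b) + q) + (a - q).
  by rewrite [RHS]addrACA subrr addr0 addrACA -opprD [RHS]addrAC.
move: (d + b) => c; rewrite [s *: (_ + (a - q))]scalerDr [RHS]addrCA -scalerDl.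
rewrite subrK scale1r scalerDr scalerBr.
rewrite scalerBl scale1r opprD opprB (addrC a) [LHS]addrACA.
by rewrite [X in _ + X = _]addrCA [LHS]addrA.
Qed.

Section dynamics.
Context {R : realType} {H : completeNormedModType R} (ip : {dot H for idfun}).
Hypothesis ipE : hilbert_norm ip.
Variables (Q : set H) (P : H -> H).
Hypotheses (cQ : convex_set Q) (PQ : is_metric_projection Q P).
Variables (lambda : R -> R) (gradf : H -> H) (x x' : R -> H).
Hypothesis x_deriv :
  forall t : R, 0 <= t -> has_derivative_in `[0, +oo[ x t (x' t).
Hypothesis x_eq :
  forall t : R, 0 <= t -> x' t + x t = P (x t - lambda t *: gradf (x t)).
Hypothesis x0Q : Q (x 0).

Let itvy (a b : R) : 0 <= a -> `[a, b] `<=` `[0, +oo[.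
Proof. by move=> a0 y; rewrite /= !in_itv/= andbT => /andP[+ _]; exact: le_trans. Qed.

Let x_cvg (t : R) : 0 <= t -> x s @[s --> within `[0, +oo[ (nbhs t)] --> x t.
Proof. by move=> /x_deriv/has_derivative_in_cvg. Qed.

(* Over a short time s the solution moves from x to about (1 - s) x + s p for
   some p in Q, so that its distance to Q does not increase to first order. *)
Lemma solution_in t : 0 <= t -> Q (x t).
Proof.
move=> t0; pose g r := `|x r - P (x r)|.
suff : g t <= g 0.
  have -> : g 0 = 0.
    by apply/le_anti; rewrite normr_ge0 andbT (le_trans ((PQ _).2 _ x0Q))// subrr normr0.
  rewrite normr_le0 subr_eq0 => /eqP ->; exact: (PQ _).1.
apply: (@straddle_le R `[0, +oo[) => //; first exact: itvy.
move=> r /andP[r0 _] e e0; set p := x' r + x r.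
have Qp : Q p by rewrite /p x_eq//; exact: (PQ _).1.
have e20 : 0 < e / 2 by rewrite divr_gt0.
have h1 := has_derivative_in_straddle (x_deriv r0).
have h2 : x uv.1 @[uv --> straddle `[0, +oo[ r] --> x r.
  exact: cvg_comp (@cvg_straddle_fst _ _ _) (x_cvg r0).
have h3 : \forall uv \near straddle `[0, +oo[ r, uv.1 < uv.2 /\ uv.2 - uv.1 <= 1.
  apply/near_straddleP; exists (1 / 2); first by rewrite divr_gt0.
  by move=> u v _ _ _ _ uv /= ? ?; split=> //; lra.
move: h1 h2 => /cvgrPdist_le/(_ _ e20) h1 /cvgrPdist_le/(_ _ e20) h2.
move: h1 h2 h3; apply: filterS3 => -[u v] /= k1 k2 [uv vu1] _ _; rewrite /g.
set s := v - u in k1 vu1 *; have s0 : 0 < s by rewrite subr_gt0.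
set w := s^-1 *: _ in k1.
have xv : x v = x u + s *: w by rewrite scalerKV ?gt_eqF// subrKC.
have := (PQ (x v)).2 _ (convex_set_combination cQ (ltW s0) vu1 Qp (PQ (x u)).1).
move=> /le_trans; apply.
have -> : x v - (s *: p + (1 - s) *: P (x u)) =
    (1 - s) *: (x u - P (x u)) + s *: ((w - x' r) + (x u - x r)).
  by rewrite xv; exact: convex_combination_error.
apply: (le_trans (ler_normD _ _)); rewrite !normrZ (gtr0_norm s0).
rewrite ger0_norm ?subr_ge0//; apply: lerD.
  by rewrite ler_piMl// gerBl ltW.
rewrite mulrC ler_pM2r//; apply: (le_trans (ler_normD _ _)).
by rewrite distrC [X in _ + X]distrC; move: k1 k2; lra.
Qed.

Variable f : H -> R.
Hypothesis f_grad : forall y z, f y + ip (gradf y) (z - y) <= f z.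
Hypothesis gradf_cont : continuous gradf.
Hypothesis lambda_gt0 : forall t : R, 0 <= t -> 0 < lambda t.

(** By the equation, [x' t + x t] is the projection of [x t - lambda t *: gradf (x t)]; this is its
    variational inequality, rearranged. *)
Lemma solution_variational_le t y : 0 <= t -> Q y ->
  `|x' t| ^+ 2 + lambda t * ip (gradf (x t)) (x' t) <=
  ip (x' t + lambda t *: gradf (x t)) (y - x t).
Proof.
move=> t0 Qy; have := metric_projection_le ipE cQ PQ (x t - lambda t *: gradf (x t)) Qy.
rewrite -x_eq// -(ipE (x' t)) !(ipDl, ipDr, ipNl, ipNr, ipZl, ipZr).
lra.
Qed.

Lemma solution_velocity_le t : 0 <= t ->
  `|x' t| ^+ 2 + lambda t * ip (gradf (x t)) (x' t) <= 0.
Proof.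
move=> t0; apply: (le_trans (solution_variational_le t0 (solution_in t0))).
by rewrite subrr linear0r.
Qed.

(** The gradient inequality at the right end bounds the increment of [f] by
    [ip (gradf (x v)) (x v - x u)]. Divided by v - u, this tends to [ip (gradf (x r)) (x' r)], which
    the velocity estimate makes nonpositive. *)
Lemma f_solution_le s t : 0 <= s -> s <= t -> f (x t) <= f (x s).
Proof.
move=> s0 st; apply: (@straddle_le R `[0, +oo[ (f \o x)) => //; first exact: itvy.
move=> r /andP[sr _] e e0; have r0 := le_trans s0 sr.
have h1 := has_derivative_in_straddle (x_deriv r0).
have h2 : x uv.2 @[uv --> straddle `[0, +oo[ r] --> x r.
  exact: cvg_comp (@cvg_straddle_snd _ _ _) (x_cvg r0).
have h3 : gradf (x uv.2) @[uv --> straddle `[0, +oo[ r] --> gradf (x r).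
  by apply: cvg_comp h2 _; exact: gradf_cont.
have h4 : ip (gradf (x r)) (x' r) < e.
  apply: le_lt_trans e0; rewrite -(pmulr_rle0 _ (lambda_gt0 r0)).
  by apply: le_trans (solution_velocity_le r0); rewrite lerDr sqr_ge0.
have h5 : \forall uv \near straddle `[0, +oo[ r, uv.1 < uv.2.
  by apply/near_straddleP; exists 1.
move: h4 => /(cvgr_lt _ (cvg_ip ipE h3 h1)) h4.
move: h4 h5; apply: filterS2 => -[u v] /= k1 uv _ _.
have vu : 0 < v - u by rewrite subr_gt0.
have := f_grad (x v) (x u).
rewrite -opprB ipNr => k2; rewrite -lerBlDl.
apply: (@le_trans _ _ (ip (gradf (x v)) (x v - x u))); first lra.
by move: k1; rewrite ipZr mulrC ltr_pdivrMr//; exact: ltW.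
Qed.

Variable G : R -> R.
Hypothesis lambda_le : forall s t : R, 0 <= s -> s <= t -> lambda t <= lambda s.
Hypothesis lambda_cvg : forall t : R, 0 <= t ->
  lambda s @[s --> within `[0, +oo[ (nbhs t)] --> lambda t.
Hypothesis G_le : forall s t : R, 0 <= s -> s <= t ->
  G t - G s <= lambda s * (t - s).

(* The derivative of |x - z|^2 / 2 + lambda (f(x) - f(z)) is at most
   - lambda (f(x) - f(z)), by the variational inequality of the projection and
   the gradient inequality at z, and f(x) is nonincreasing. *)
Lemma energy_le z s t : Q z -> (forall y, Q y -> f z <= f y) ->
  0 <= s -> s <= t ->
  `|x t - z| ^+ 2 / 2 + lambda t * (f (x t) - f z) +
    (G t - G s) * (f (x t) - f z) <=
  `|x s - z| ^+ 2 / 2 + lambda s * (f (x s) - f z).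
Proof.
move=> Qz zmin s0 st; set E := f (x t) - f z.
(* The gap is frozen at its final value [E]. As [f] decreases along the solution, [lambda r * E] is
   at most the decay rate [lambda r * (f (x r) - f z)]. *)
pose g r := `|x r - z| ^+ 2 / 2 + lambda r * (f (x r) - f z) + G r * E.
suff : g t <= g s by rewrite /g -/E; lra.
have E0 : 0 <= E by rewrite subr_ge0; apply: zmin; apply: solution_in; exact: le_trans st.
apply: (@straddle_le R `[0, +oo[) => //; first exact: itvy.
move=> r /andP[sr rt] e e0; have r0 := le_trans s0 sr.
have h1 := has_derivative_in_straddle (x_deriv r0).
have h2 : x uv.2 @[uv --> straddle `[0, +oo[ r] --> x r.
  exact: cvg_comp (@cvg_straddle_snd _ _ _) (x_cvg r0).
have h3 : gradf (x uv.2) @[uv --> straddle `[0, +oo[ r] --> gradf (x r).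
  by apply: cvg_comp h2 _; exact: gradf_cont.
have h4 : lambda uv.1 @[uv --> straddle `[0, +oo[ r] --> lambda r.
  exact: cvg_comp (@cvg_straddle_fst _ _ _) (lambda_cvg r0).
have h5 : \forall uv \near straddle `[0, +oo[ r, uv.1 < uv.2.
  by apply/near_straddleP; exists 1.
have h6 : ip (x r - z + lambda r *: gradf (x r)) (x' r) + lambda r * E < e.
  apply: le_lt_trans e0.
  have := solution_variational_le r0 Qz.
  have : lambda r * E <= lambda r * (f (x r) - f z).
    by rewrite ler_pM2l ?lambda_gt0// lerB// f_solution_le.
  have : lambda r * (f (x r) + ip (gradf (x r)) (z - x r)) <= lambda r * f z.
    by rewrite ler_pM2l ?lambda_gt0.
  have : 0 <= `|x' r| ^+ 2 by rewrite sqr_ge0.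
  rewrite !(ipDl, ipDr, ipNl, ipNr, ipZl, ipZr) (ipC ip (x r)) (ipC ip z).
  lra.
have : ip (x uv.2 - z + lambda uv.1 *: gradf (x uv.2))
          ((uv.2 - uv.1)^-1 *: (x uv.2 - x uv.1)) + lambda uv.1 * E
       @[uv --> straddle `[0, +oo[ r] -->
       ip (x r - z + lambda r *: gradf (x r)) (x' r) + lambda r * E.
  apply: cvgD; last exact: cvgMr_tmp.
  apply: (cvg_ip ipE) => //; apply: cvgD; last exact: cvgZ.
  by apply: cvgB => //; exact: cvg_cst.
move=> h; move: h6 => /(cvgr_lt _ h); move: h5; apply: filterS2 => -[u v] /= uv k su vt.
have u0 := le_trans s0 su; have vu : 0 < v - u by rewrite subr_gt0.
have := f_grad (x v) (x u); rewrite -opprB ipNr => k2.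
have {}k2 : lambda u * (f (x v) - f (x u)) <=
    lambda u * ip (gradf (x v)) (x v - x u).
  by rewrite ler_pM2l ?lambda_gt0//; lra.
have k3 := ip_half_sqr ipE (x v - z) (x u - z).
rewrite (_ : x v - z - (x u - z) = x v - x u) in k3; last first.
  by rewrite opprB addrA subrK.
have k4 : G v * E - G u * E <= lambda u * (v - u) * E.
  by rewrite -mulrBl ler_wpM2r// G_le// ltW.
(* Monotonicity of [lambda] disposes of the term that its derivative would contribute. *)
have k5 : lambda v * (f (x v) - f z) <= lambda u * (f (x v) - f z).
  rewrite ler_wpM2r ?lambda_le//; last exact: ltW.
  by rewrite subr_ge0; apply: zmin; apply: solution_in; rewrite (le_trans u0)// ltW.
have {}k : ip (x v - z) (x v - x u) + lambda u * ip (gradf (x v)) (x v - x u) +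
    lambda u * (v - u) * E <= e * (v - u).
  have : (v - u) * (ip (x v - z + lambda u *: gradf (x v))
    ((v - u)^-1 *: (x v - x u)) + lambda u * E) <= (v - u) * e.
    by rewrite ler_pM2l// ltW.
  rewrite ipZr ipDl ipZl mulrDr mulVKf ?gt_eqF//; lra.
rewrite /g; move: k k2 k3 k4 k5; lra.
Qed.

End dynamics.

(** * The step size and its integral *)

Lemma Rintegral_cst_itv (R : realType) (s t c : R) : s <= t ->
  \int[@lebesgue_measure R]_(r in `]s, t]) c = c * (t - s).
Proof.
move=> st; rewrite Rintegral_cst//; congr (_ * _).
rewrite [X in fine X](lebesgue_measure_itv `]s, t])/= lte_fin.
by move: st; rewrite le_eqVlt => /predU1P[->|->//]; rewrite ltxx subrr.
Qed.

Section step_size.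
Context {R : realType} (lambda : R -> R).
Hypothesis lambda_gt0 : forall t : R, 0 <= t -> 0 < lambda t.
Hypothesis lambda_ac : forall T : R, 0 <= T -> abs_continuous_on 0 T lambda.
Hypothesis lambda'_le0 : {ae @lebesgue_measure R, forall t : R, 0 <= t ->
  derivable lambda t 1 /\ lambda^`()%classic t <= 0}.

Lemma step_size_le (s t : R) : 0 <= s -> s <= t -> lambda t <= lambda s.
Proof.
move=> s0 st; apply: abs_continuous_le => //.
  move=> e e0; have [d d0 hd] := lambda_ac (le_trans s0 st) e0.
  exists d => // n a b ab; apply: hd => i.
  by have [sa ? ?] := ab i; split=> //; exact: le_trans sa.
have [N [mN N0 hN]] := lambda'_le0; exists N; split=> // r /= hr.
apply: hN => /= h; apply: hr => /andP[sr _].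
by apply: h; exact: le_trans sr.
Qed.

Lemma step_size_cvg (t : R) : 0 <= t ->
  lambda s @[s --> within `[0, +oo[ (nbhs t)] --> lambda t.
Proof.
move=> t0; apply/cvgrPdist_lt => e e0.
have t10 : 0 <= t + 1 by lra.
have [d d0 hd] := lambda_ac t10 e0.
have key a b : 0 <= a -> a <= b -> b <= t + 1 -> b - a < d ->
    `|lambda b - lambda a| < e.
  move=> a0 ab bt bad; have := hd 1%N (fun=> a) (fun=> b).
  rewrite !big_ord_recl !big_ord0 !addr0; apply=> //.
  by move=> i j _ _ _; rewrite !ord1.
rewrite near_withinE; apply/nbhs_ballP; exists (Num.min 1 d) => /=.
  by rewrite lt_min ltr01.
move=> s; rewrite /ball/= lt_min => /andP[st1 std]; rewrite in_itv/= andbT => s0.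
have [ts|st] := leP t s.
  by rewrite distrC; apply: key => //; move: st1 std; rewrite !ltr_norml; lra.
by apply: key; move: st1 std st; rewrite ?ltr_norml; lra.
Qed.

Lemma step_size_continuous : {within `[0, +oo[, continuous lambda}.
Proof.
apply/subspace_continuousP => t; rewrite /= in_itv/= andbT.
exact: step_size_cvg.
Qed.

Lemma step_size_integrable (t : R) :
  (@lebesgue_measure R).-integrable `[0, t] (EFin \o lambda).
Proof.
apply: continuous_compact_integrable; first exact: segment_compact.
apply: continuous_subspaceW step_size_continuous => s /=.
by rewrite !in_itv/= andbT => /andP[].
Qed.

Lemma GammaB (s t : R) : 0 <= s -> s <= t ->
  Gamma lambda t - Gamma lambda s =
  \int[@lebesgue_measure R]_(r in `]s, t]) lambda r.
Proof.
move=> s0 st; rewrite /Gamma Rintegral_itvB//.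
exact: step_size_integrable.
Qed.

Let itv_integrable (s t : R) : 0 <= s -> s <= t ->
  (@lebesgue_measure R).-integrable `]s, t] (EFin \o lambda).
Proof.
move=> s0 st; apply: integrableS (step_size_integrable t) => //.
by apply: subset_itvr; rewrite bnd_simp.
Qed.

Let cst_integrable (s t c : R) :
  (@lebesgue_measure R).-integrable `]s, t] (EFin \o cst c).
Proof.
have h : (@lebesgue_measure R).-integrable `[s, t] (EFin \o cst c).
  apply: continuous_compact_integrable; first exact: segment_compact.
  by apply: continuous_subspaceT; exact: cst_continuous.
by apply: integrableS h => //; apply: subset_itvr; rewrite bnd_simp.
Qed.

(** With [Gamma_ge], the chord bounds expressing that [Gamma] is concave, since its density [lambda]
    is nonincreasing. *)
Lemma Gamma_le (s t : R) : 0 <= s -> s <= t ->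
  Gamma lambda t - Gamma lambda s <= lambda s * (t - s).
Proof.
move=> s0 st; rewrite GammaB//.
have -> : lambda s * (t - s) = \int[@lebesgue_measure R]_(r in `]s, t]) lambda s.
  by rewrite Rintegral_cst_itv.
apply: le_Rintegral => //; [exact: itv_integrable|exact: cst_integrable|].
by move=> r /=; rewrite in_itv/= => /andP[sr _]; rewrite step_size_le// ltW.
Qed.

Lemma Gamma_ge (s t : R) : 0 <= s -> s <= t ->
  lambda t * (t - s) <= Gamma lambda t - Gamma lambda s.
Proof.
move=> s0 st; rewrite GammaB//.
have -> : lambda t * (t - s) = \int[@lebesgue_measure R]_(r in `]s, t]) lambda t.
  by rewrite Rintegral_cst_itv.
apply: le_Rintegral => //; [exact: cst_integrable|exact: itv_integrable|].
move=> r /=; rewrite in_itv/= => /andP[sr rt]; rewrite step_size_le//.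
by rewrite (le_trans s0)// ltW.
Qed.

Lemma Gamma0 : Gamma lambda 0 = 0.
Proof. by rewrite /Gamma set_itv1 Rintegral_set1. Qed.

Lemma Gamma_homo (s t : R) : 0 <= s -> s <= t -> Gamma lambda s <= Gamma lambda t.
Proof.
move=> s0 st; rewrite -subr_ge0; apply: le_trans (Gamma_ge s0 st).
by rewrite mulr_ge0 ?subr_ge0// ltW// lambda_gt0// (le_trans s0).
Qed.

Lemma Gamma_gt0 (t : R) : 0 < t -> 0 < Gamma lambda t.
Proof.
move=> t0; have := Gamma_ge (lexx 0) (ltW t0); rewrite Gamma0 !subr0.
by apply: lt_le_trans; rewrite mulr_gt0// lambda_gt0// ltW.
Qed.

(** Concavity: the increase over [0, t/2] is at least [lambda (t / 2) * (t / 2)], the one over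
    [t/2, t] at most that. *)
Lemma Gamma_half (t : R) : 0 <= t -> Gamma lambda t / 2 <= Gamma lambda (t / 2).
Proof.
move=> t0; have t20 : 0 <= t / 2 by rewrite divr_ge0.
have t2t : t / 2 <= t by lra.
have := Gamma_le t20 t2t; have := Gamma_ge (lexx 0) t20; rewrite Gamma0.
lra.
Qed.

Lemma Gamma_continuous : {within `[0, +oo[, continuous (Gamma lambda)}.
Proof.
have l0 := lambda_gt0 (lexx 0).
have lip (s t : R) : 0 <= s -> s <= t ->
    `|Gamma lambda t - Gamma lambda s| <= lambda 0 * (t - s).
  move=> s0 st; rewrite ger0_norm ?subr_ge0 ?Gamma_homo//.
  apply: (le_trans (Gamma_le s0 st)).
  by rewrite ler_wpM2r ?subr_ge0// step_size_le.
apply/subspace_continuousP => t; rewrite /= in_itv/= andbT => t0.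
apply/cvgrPdist_lt => e e0; rewrite near_withinE; apply/nbhs_ballP.
exists (e / lambda 0) => /=; first by rewrite divr_gt0.
move=> s; rewrite /ball/= ltr_pdivlMr// mulrC => st; rewrite in_itv/= andbT => s0.
apply: le_lt_trans st; have [ts|st] := leP t s.
  by rewrite distrC (distrC t) (ger0_norm (_ : 0 <= s - t)) ?subr_ge0// lip.
by rewrite (gtr0_norm (_ : 0 < t - s)) ?subr_gt0// lip// ltW.
Qed.

(** Supplies the earlier times to which the decay iterations go back. *)
Lemma Gamma_IVT (t c : R) : 0 <= t -> 0 <= c -> c <= Gamma lambda t ->
  exists s, [/\ 0 <= s, s <= t & Gamma lambda s = c].
Proof.
move=> t0 c0 ct; have Gt0 := le_trans c0 ct.
have [||s] := @IVT R (Gamma lambda) 0 t c t0.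
- apply: continuous_subspaceW Gamma_continuous => s /=.
  by rewrite !in_itv/= andbT => /andP[].
- by rewrite Gamma0 min_l// max_r// c0.
by rewrite in_itv/= => /andP[s0 st] sc; exists s.
Qed.

End step_size.

(** * Decay of the gap *)

Section decay.
Context {R : realType} (E G : R -> R) (C : R).
Hypotheses (E_ge0 : forall t : R, 0 <= t -> 0 <= E t)
  (E_le : forall s t : R, 0 <= s -> s <= t -> E t <= E s) (C_gt0 : 0 < C)
  (G0 : G 0 = 0) (G_gt0 : forall t : R, 0 < t -> 0 < G t)
  (G_ivt : forall t c : R, 0 <= t -> 0 <= c -> c <= G t ->
    exists s, [/\ 0 <= s, s <= t & G s = c]).

(* Iterating the hypothesis along times that halve G; the exponent of G is the
   one for which it reproduces itself. *)
Lemma power_decay (a : R) : 0 < a -> a < 1 ->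
  (forall s t : R, 0 <= s -> s <= t -> E t * (G t - G s) <= C * E s `^ a) ->
  exists2 K, 0 < K & forall t, 0 < t -> E t <= K * G t `^ (- (1 - a)^-1).
Proof.
move=> a0 a1 EG; set b := (1 - a)^-1.
have a1' : 0 < 1 - a by rewrite subr_gt0.
have b0 : 0 < b by rewrite invr_gt0.
have ab : - (a * b) = - b + 1.
  by rewrite /b; field; rewrite gt_eqF.
pose B := 2^-1 `^ (- (a * b)); pose A := 2 * C * B.
have B0 : 0 < B by rewrite powR_gt0.
have A0 : 0 < A by rewrite !mulr_gt0.
(* The entry [E 0] serves the start of the induction, where G is at most 1; the entry [A]^ b[gives]A
   * K [^ a <= K], which closes the induction step; 1 makes [K] positive. *)
pose K := Num.max 1 (Num.max (E 0) (A `^ b)).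
have K0 : 0 < K by rewrite lt_max ltr01.
have KE : E 0 <= K by rewrite /K !le_max lexx orbT.
have KA : A * K `^ a <= K.
  have : A <= K `^ (1 - a).
    have -> : A = (A `^ b) `^ (1 - a).
      by rewrite -powRrM mulVf ?gt_eqF// powRr1// ltW.
    rewrite ge0_ler_powR ?nnegrE ?powR_ge0 ?(ltW K0) ?(ltW a1')//.
    by rewrite /K !le_max lexx !orbT.
  rewrite -(ler_pM2r (powR_gt0 a K0)) => /le_trans; apply.
  rewrite -powRD; last by rewrite (gt_eqF K0) implybT.
  by rewrite subrK powRr1// ltW.
exists K => // t t0.
have [n] : exists n : nat, G t <= 2 ^+ n.
  exists (Num.truncn (G t)).+1.
  apply: (@le_trans _ _ (Num.truncn (G t)).+1%:R).
    by rewrite ltW// truncnS_gt.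
  by rewrite -natrX ler_nat ltnW// ltn_expl.
elim: n t t0 => [|n ih] t t0 Gt; have Gt0 := G_gt0 t0.
  rewrite expr0 in Gt; apply: (@le_trans _ _ K).
    by apply: le_trans KE; apply: E_le => //; exact: ltW.
  rewrite ler_peMr ?(ltW K0)// powRN invf_ge1 ?powR_gt0//.
  have <- : 1 `^ b = 1 by rewrite powR1.
  by rewrite ge0_ler_powR ?nnegrE//; exact: ltW.
have [s [s0 st sE]] : exists s, [/\ 0 <= s, s <= t & G s = G t / 2].
  by apply: G_ivt; [exact: ltW|rewrite divr_ge0// ltW|lra].
have {}s0 : 0 < s.
  rewrite lt_neqAle s0 andbT; apply/eqP => s0'.
  by move: sE; rewrite -s0' G0; lra.
have ihs : E s <= K * (G t / 2) `^ (- b).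
  by rewrite -sE; apply: ih => //; rewrite sE ler_pdivrMr// -exprSr.
have Es : E s `^ a <= K `^ a * (B * (G t `^ (- b) * G t)).
  apply: (@le_trans _ _ ((K * (G t / 2) `^ (- b)) `^ a)).
    rewrite ge0_ler_powR ?nnegrE ?(ltW a0) ?E_ge0 ?(ltW s0)//.
    by rewrite mulr_ge0 ?powR_ge0 ?(ltW K0).
  rewrite (@powRM _ K) ?powR_ge0 ?(ltW K0)// -powRrM mulNr (mulrC b).
  rewrite (@powRM _ (G t)) ?(ltW Gt0)// -/B ab powRD; last first.
    by rewrite (gt_eqF Gt0) implybT.
  by rewrite powRr1 ?(ltW Gt0)// (mulrC B).
have := EG s t (ltW s0) st; rewrite sE (_ : G t - G t / 2 = G t / 2); last lra.
move=> h; rewrite -(ler_pM2r Gt0).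
apply: (@le_trans _ _ (2 * (C * (K `^ a * (B * (G t `^ (- b) * G t)))))).
  have : C * E s `^ a <= C * (K `^ a * (B * (G t `^ (- b) * G t))).
    by rewrite ler_pM2l.
  move: h; lra.
rewrite -(mulrA K) (_ : 2 * _ = A * K `^ a * (G t `^ (- b) * G t)).
  by rewrite ler_wpM2r// mulr_ge0 ?powR_ge0 ?(ltW Gt0).
by rewrite /A; ring.
Qed.

(** Between times whose values of [G] differ by 2 C, the hypothesis halves [E]; hence the rate ln 2
    / (2 C). *)
Lemma exponential_decay :
  (forall s t : R, 0 <= s -> s <= t -> E t * (G t - G s) <= C * E s) ->
  exists K mu, [/\ 0 < K, 0 < mu &
    forall t, 0 <= t -> E t <= K * expR (- mu * G t)].
Proof.
move=> EG; pose mu := ln 2 / (2 * C).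
have C20 : 0 < 2 * C by rewrite mulr_gt0.
have ln20 : 0 < ln (2 : R) by rewrite ln_gt0// ltr1n.
have mu0 : 0 < mu by rewrite divr_gt0.
have E00 : 0 <= E 0 by exact: E_ge0.
have muC : expR (mu * (2 * C)) = 2 by rewrite /mu divfK ?gt_eqF// lnK// posrE.
(* The factor 2 pays for the incomplete last stretch, where [G t <= 2 * C] and the exponential is at
   least 1/2; adding 1 keeps [K] positive when [E 0] is 0. *)
pose K := 2 * (E 0 + 1); have K0 : 0 < K by rewrite /K mulr_gt0//; lra.
exists K, mu; split=> // t t0.
have [n] : exists n : nat, G t <= 2 * C * n%:R.
  exists (Num.truncn (G t / (2 * C))).+1; rewrite -ler_pdivrMl// mulrC.
  by rewrite ltW// truncnS_gt.
elim: n t t0 => [|n ih] t t0 Gt.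
  have Gt0 : - mu * G t >= 0.
    by rewrite mulNr oppr_ge0 pmulr_rle0//; move: Gt; rewrite mulr0.
  apply: (@le_trans _ _ K); last first.
    by rewrite ler_peMr ?(ltW K0)// -expR0 ler_expR.
  by apply: (le_trans (E_le (lexx 0) t0)); rewrite /K; lra.
have [Gs|Gs] := leP (G t) (2 * C).
  apply: (@le_trans _ _ (K / 2)).
    by apply: (le_trans (E_le (lexx 0) t0)); rewrite /K; lra.
  rewrite ler_pM2l// mulNr expRN lef_pV2 ?posrE ?expR_gt0//.
  by rewrite -muC ler_expR ler_pM2l.
have [s [s0 st sE]] : exists s, [/\ 0 <= s, s <= t & G s = G t - 2 * C].
  by apply: G_ivt => //; lra.
have ihs : E s <= K * expR (- mu * (G t - 2 * C)).
  by rewrite -sE; apply: ih => //; rewrite sE; move: Gt; rewrite -natr1; lra.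
have := EG s t s0 st; rewrite sE opprB [_ + (_ - _)]addrC subrK => h.
have {}h : E t * 2 <= E s by rewrite -(ler_pM2l C_gt0); lra.
have : - mu * (G t - 2 * C) = - mu * G t + mu * (2 * C) by ring.
move=> e; rewrite e expRD muC in ihs; lra.
Qed.

End decay.

(** * Integral conditions and convergence *)

Lemma nonincreasing_measurable_itvcy (R : realType) (a : R) (h : R -> R) :
  (forall s t, a <= s -> s <= t -> h t <= h s) ->
  measurable_fun `[a, +oo[ h.
Proof.
move=> hh; apply: (eq_measurable_fun (fun t => h (Num.max a t))).
  by move=> t; rewrite inE/= in_itv/= andbT => at_; rewrite max_r.
apply: nonincreasing_measurable => // s t st; apply: hh.
  by rewrite le_max lexx.
by rewrite ge_max !le_max lexx st orbT.
Qed.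

Lemma le_integral_itvcy (R : realType) (a b c : R) (h : R -> R) :
  a <= b -> 0 <= c -> measurable_fun `[a, +oo[ h ->
  (forall t, a <= t -> 0 <= h t) -> (forall t, a <= t -> t <= b -> c <= h t) ->
  ((c * (b - a))%:E <= \int[@lebesgue_measure R]_(t in `[a, b]) (h t)%:E)%E.
Proof.
move=> ab c0 mh h0 hc.
apply: (@le_trans _ _ (\int[@lebesgue_measure R]_(t in `[a, b]) (cst c%:E t))%E).
  rewrite integral_cst// [X in (_ <= _ * X)%E](lebesgue_measure_itv `[a, b])/= lte_fin.
  move: ab; rewrite le_eqVlt => /predU1P[->|->//]; rewrite ltxx subrr mule0 mulr0//.
have mab : measurable_fun `[a, b] h.
  apply: measurable_funS mh => //; exact: subset_itvl.
apply: ge0_le_integral => //; first by apply/measurable_EFinP.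
by move=> t /=; rewrite in_itv/= lee_fin => /andP[at_ tb]; exact: hc.
Qed.

Section log_integrable.
Context {R : realType} (h : R -> R).
Hypothesis h_ge0 : forall t, 1 <= t -> 0 <= h t.
Hypothesis h_le : forall s t, 1 <= s -> s <= t -> h t <= h s.
Hypothesis h_int : (\int[@lebesgue_measure R]_(t in `[1%R, +oo[)
  ((1 + t)^-1 * h t)%:E < +oo)%E.

Let g t := (1 + t)^-1 * h t.

Let g_ge0 t : 1 <= t -> 0 <= g t.
Proof. by move=> t1; rewrite mulr_ge0 ?invr_ge0 ?h_ge0//; lra. Qed.

Let mg : measurable_fun `[(1 : R), +oo[ g.
Proof.
apply: nonincreasing_measurable_itvcy => s t s1 st; rewrite /g.
apply: ler_pM; rewrite ?invr_ge0 ?h_ge0 ?h_le ?lef_pV2 ?posrE//; lra.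
Qed.

(* Each dyadic interval [2^n, 2^(n+1)] contributes at least inf h / 3. *)
Lemma log_integrable_small e : 0 < e -> exists2 t, 1 <= t & h t < e.
Proof.
move=> e0; apply: contrapT => hn.
have he t : 1 <= t -> e <= h t.
  by move=> t1; rewrite leNgt; apply/negP => ht; apply: hn; exists t.
have p1 n : 1 <= 2 ^+ n :> R by rewrite exprn_ege1// ler1n.
have key n : ((n%:R * (e / 3))%:E <=
    \int[@lebesgue_measure R]_(t in `[1%R, (2 ^+ n)%R[) (g t)%:E)%E.
  elim: n => [|n ih].
    rewrite mul0r; apply: integral_ge0 => t /=.
    by rewrite in_itv/= lee_fin => /andP[? _]; exact: g_ge0.
  have n1 : 2 ^+ n <= 2 ^+ n.+1 :> R by rewrite exprS; have := p1 n; lra.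
  rewrite (@itv_bndbnd_setU _ _ _ (BLeft (2 ^+ n)))// ?bnd_simp//.
  rewrite ge0_integral_setU//=; first last.
  - apply/disj_setPS => t [/=]; rewrite !in_itv/= => /andP[_ t1] /andP[].
    by rewrite leNgt t1.
  - move=> t /= []; rewrite in_itv/= lee_fin => /andP[t1 _]; apply: g_ge0 => //.
    exact: le_trans t1.
  - apply/measurable_EFinP; apply: measurable_funS mg => //.
    rewrite -itv_bndbnd_setU// ?bnd_simp//; exact: subset_itvl.
  rewrite -natr1 mulrDl mul1r EFinD; apply: leeD => //.
  have mgn : measurable_fun `[(2 ^+ n : R), +oo[ g.
    by apply: measurable_funS mg => //; apply: subset_itvr; rewrite bnd_simp.
  (* The integrand is at least e / (1 + 2^(n+1)) on an interval of length 2^n, and 2^n / (1 +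
     2^(n+1)) >= 1/3. *)
  have := @le_integral_itvcy R (2 ^+ n) (2 ^+ n.+1) (e / (1 + 2 ^+ n.+1)) g n1.
  rewrite -integral_itv_bndo_bndc; last first.
    apply/measurable_EFinP; apply: measurable_funS mgn => //; exact: subset_itvl.
  move=> le; apply: le_trans (le _ mgn _ _).
  - rewrite lee_fin mulrAC ler_pdivlMr; last by have := p1 n.+1; lra.
    rewrite -mulrA ler_pM2l// exprS; have := p1 n; lra.
  - by rewrite divr_ge0 ?(ltW e0)//; have := p1 n.+1; lra.
  - by move=> t t1; apply: g_ge0; exact: le_trans (p1 n) t1.
  - move=> t t1 t2; have t1' := le_trans (p1 n) t1; rewrite /g mulrC.
    by apply: ler_pM; rewrite ?invr_ge0 ?(ltW e0) ?he ?lef_pV2 ?posrE//;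
       have := p1 n.+1; lra.
pose I := (\int[@lebesgue_measure R]_(t in `[1%R, +oo[) (g t)%:E)%E.
have I0 : (0 <= I)%E.
  by apply: integral_ge0 => t /=; rewrite in_itv/= lee_fin andbT; exact: g_ge0.
have If : I \is a fin_num by rewrite ge0_fin_numE.
pose n := (Num.truncn (fine I / (e / 3))).+1.
have := truncnS_gt (fine I / (e / 3)); rewrite -/n ltr_pdivrMr ?divr_gt0//.
rewrite ltNge => /negP; apply; rewrite -lee_fin fineK//.
apply: (le_trans (key n)); apply: ge0_subset_integral => //.
- exact/measurable_EFinP.
- by move=> t /=; rewrite in_itv/= lee_fin andbT; exact: g_ge0.
- exact: subset_itvl.
Qed.

(** The integrand is at least h(2t) / (2t) on [t, 2t], an interval of length t. *)
Lemma log_integrable_tail t : 1 <= t ->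
  h (2 * t) / 2 <= \int[@lebesgue_measure R]_(s in `[t, +oo[) (s^-1 * h s).
Proof.
move=> t1; pose k s := s^-1 * h s.
have k0 s : t <= s -> 0 <= k s.
  by move=> ts; rewrite mulr_ge0 ?invr_ge0 ?h_ge0//; lra.
have k_le s r : t <= s -> s <= r -> k r <= k s.
  move=> ts sr; apply: ler_pM; rewrite ?invr_ge0 ?h_ge0 ?h_le ?lef_pV2 ?posrE//; lra.
have mk : measurable_fun `[t, +oo[ k by exact: nonincreasing_measurable_itvcy.
have sub : `[t, +oo[ `<=` `[(1 : R), +oo[ by apply: subset_itvr; rewrite bnd_simp.
have I0 : (0 <= \int[@lebesgue_measure R]_(s in `[t, +oo[) (k s)%:E)%E.
  by apply: integral_ge0 => s /=; rewrite in_itv/= lee_fin andbT; exact: k0.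
(* Finiteness matters because the real-valued integral is 0 when the extended one is infinite. It
   holds as 1/s <= 2 / (1 + s) for s >= 1. *)
have Ioo : (\int[@lebesgue_measure R]_(s in `[t, +oo[) (k s)%:E < +oo)%E.
  apply: (@le_lt_trans _ _
      (2%:E * \int[@lebesgue_measure R]_(s in `[1%R, +oo[) (g s)%:E)%E); last first.
    by rewrite lte_mul_pinfty.
  rewrite -ge0_integralZl_EFin//; last 2 first.
    by move=> s /=; rewrite in_itv/= lee_fin andbT; exact: g_ge0.
    exact/measurable_EFinP.
  apply: (@le_trans _ _
      (\int[@lebesgue_measure R]_(s in `[t, +oo[) (2%:E * (g s)%:E))%E).
    apply: ge0_le_integral => //.
    - by move=> s /=; rewrite in_itv/= lee_fin andbT; exact: k0.
    - exact/measurable_EFinP.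
    - apply/measurable_EFinP/measurable_funM => //.
      exact: measurable_funS mg.
    - move=> s /=; rewrite in_itv/= andbT -EFinM lee_fin => ts.
      rewrite /k /g mulrA ler_wpM2r ?h_ge0//; first lra.
      by rewrite -ler_pdivrMl// -invfM lef_pV2 ?posrE; lra.
  apply: ge0_subset_integral => //.
  - by apply/measurable_EFinP/measurable_funM.
  - move=> s /=; rewrite in_itv/= andbT -EFinM lee_fin => s1.
    by rewrite mulr_ge0// g_ge0.
have If : (\int[@lebesgue_measure R]_(s in `[t, +oo[) (k s)%:E)%E \is a fin_num.
  by rewrite ge0_fin_numE.
rewrite -lee_fin /Rintegral fineK//.
have t2 : t <= 2 * t by lra.
apply: (@le_trans _ _ (k (2 * t) * (2 * t - t))%:E).
  rewrite lee_fin /k invfM; have : t^-1 * t = 1 by rewrite mulVf// gt_eqF//; lra.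
  move=> tt; rewrite (_ : _ * (2 * t - t) = h (2 * t) / 2 * (t^-1 * t)); last by ring.
  by rewrite tt mulr1.
apply: (le_trans (@le_integral_itvcy R t (2 * t) (k (2 * t)) k t2 _ mk _ _)) => //.
- by apply: k0.
- by move=> s ts s2t; exact: k_le.
apply: ge0_subset_integral => //.
- exact/measurable_EFinP.
- by move=> s /=; rewrite in_itv/= lee_fin andbT; exact: k0.
- exact: subset_itvl.
Qed.

End log_integrable.

(** Since [b s] bounds all displacements after [s], small values of [b] make [x] Cauchy, and the
    bound passes to the limit as a closed condition. *)
Lemma cvg_of_modulus (R : realType) (V : completeNormedModType R) (x : R -> V)
    (b : R -> R) :
  (forall s t : R, 0 <= s -> s <= t -> `|x t - x s| <= b s) ->
  (forall e : R, 0 < e -> exists2 s, 0 <= s & b s <= e) ->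
  exists2 l, x t @[t --> +oo] --> l & forall s : R, 0 <= s -> `|x s - l| <= b s.
Proof.
move=> xb b0; have cx : cvg (x t @[t --> +oo]).
  apply: cauchy_cvg; apply: cauchy_exP => e e0.
  have [s s0 bs] : exists2 s, 0 <= s & b s <= e / 2 by apply: b0; rewrite divr_gt0.
  exists (x s); rewrite /nbhs/=.
  have : \forall t \near +oo, s <= t by exact: (nbhs_pinfty_ge (num_real s)).
  apply: filterS => t st; rewrite -ball_normE/= distrC.
  by apply: (le_lt_trans (xb _ _ s0 st)); apply: (le_lt_trans bs); lra.
exists (lim (x t @[t --> +oo])) => // s s0.
apply: (@closed_cvg _ _ (+oo : set_system R) _ (fun t => `|x s - x t|)
  (fun r => r <= b s)).
- exact: closed_le.
- have : \forall t \near +oo, s <= t by exact: (nbhs_pinfty_ge (num_real s)).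
  by apply: filterS => t st; rewrite distrC; exact: xb.
- by apply: cvg_norm; apply: cvgB => //; exact: cvg_cst.
Qed.

Lemma le_powRN (R : realType) (a b r : R) : 0 < a -> a <= b -> 0 <= r ->
  b `^ (- r) <= a `^ (- r).
Proof.
move=> a0 ab r0; have b0 := lt_le_trans a0 ab.
by rewrite !powRN lef_pV2 ?posrE ?powR_gt0// ge0_ler_powR// nnegrE ltW.
Qed.

Theorem theorem1p3
  (R : realType) (H : completeNormedModType R)
  (ip : {dot H for idfun}) (H_hilbert : hilbert_norm ip)
  (Q : set H) (Q_closed : closed Q) (Q_convex : convex_set Q)
  (Q_nonempty : Q !=set0)
  (P : H -> H) (P_proj : is_metric_projection Q P)
  (lambda : R -> R)
  (lambda_gt0 : forall t : R, 0 <= t -> 0 < lambda t)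
  (lambda_ac : forall T : R, 0 <= T -> abs_continuous_on 0 T lambda)
  (f : H -> R) (gradf : H -> H)
  (f_convex : convex_function setT f)
  (f_grad : is_gradient ip f gradf)
  (f_C1 : continuous gradf)
  (gradf_lip : locally_lipschitz gradf)
  (fQ : R) (fQ_min : is_min_on f Q fQ)
  (lambda'_le0 : {ae @lebesgue_measure R, forall t : R, 0 <= t ->
     derivable lambda t 1 /\ lambda^`()%classic t <= 0})
  (kappa theta : R) (kappa_gt0 : 0 < kappa)
  (theta_gt0 : 0 < theta) (theta_le : theta <= 1 / 2)
  (f_growth : forall x, Q x ->
     kappa * dist x (argmin_on f Q fQ) <= (f x - fQ) `^ theta)
  (x0 : H) (x0Q : Q x0)
  (x : R -> H) (x_sol : is_C1_solution P lambda gradf x0 x) :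
  (theta < 1 / 2 ->
   (\int[@lebesgue_measure R]_(t in `[1%R, +oo[)
      ((1 + t)^-1 * Gamma lambda t `^ (- (theta / (1 - 2 * theta))))%:E
      < +oo)%E ->
   exists xoo : H,
     [/\ argmin_on f Q fQ xoo,
         x t @[t --> +oo] --> xoo,
         (fun t => `|x t - xoo|) =O_+oo
           (fun t => \int[@lebesgue_measure R]_(s in `[t, +oo[)
              (s^-1 * Gamma lambda s `^ (- (theta / (1 - 2 * theta)))))
       & (fun t => f (x t) - fQ) =O_+oo
           (fun t => Gamma lambda t `^ (- (2 * theta / (1 - 2 * theta)))
              / (t * lambda t))])
  /\
  (theta = 1 / 2 ->
   (forall c : R, 0 < c ->
      (\int[@lebesgue_measure R]_(t in `[0%R, +oo[)
         ((1 + t)^-1 * expR (- c * Gamma lambda t))%:E < +oo)%E) ->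
   exists xoo : H,
     [/\ argmin_on f Q fQ xoo,
         x t @[t --> +oo] --> xoo
       & exists mu : R,
         [/\ 0 < mu,
             (fun t => `|x t - xoo|) =O_+oo
               (fun t => expR (- mu * Gamma lambda t))
           & (fun t => f (x t) - fQ) =O_+oo
               (fun t => expR (- mu * Gamma lambda t))]]).
Proof.

(* The flow, the gap [E] and the integral [G] of the step size *)
have [x' [xd _ xe x0E]] := x_sol.
have [[z0 Qz0 fz0] fmin] := fQ_min.
have Qx0 : Q (x 0) by rewrite x0E.
have Qx t : 0 <= t -> Q (x t).
  by move=> t0; exact: (solution_in Q_convex P_proj xd xe Qx0 t0).
have fg y z : f y + ip (gradf y) (z - y) <= f z.
  exact: convex_gradient_le f_convex f_grad.
have lle := step_size_le lambda_ac lambda'_le0.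
pose G := Gamma lambda; pose E t := f (x t) - fQ.
have G0 : G 0 = 0 by exact: Gamma0.
have G_gt0 t : 0 < t -> 0 < G t.
  by move=> t0; exact: (Gamma_gt0 lambda_gt0 lambda_ac lambda'_le0).
have G_half t : 0 <= t -> G t / 2 <= G (t / 2).
  by move=> t0; exact: (Gamma_half lambda_ac lambda'_le0).
have G_homo s t : 0 <= s -> s <= t -> G s <= G t.
  by move=> s0 st; exact: (Gamma_homo lambda_gt0 lambda_ac lambda'_le0).
have G_ivt t c : 0 <= t -> 0 <= c -> c <= G t ->
    exists s, [/\ 0 <= s, s <= t & G s = c].
  by move=> t0 c0 cG; exact: (Gamma_IVT lambda_gt0 lambda_ac lambda'_le0).
have E_ge0 t : 0 <= t -> 0 <= E t by move=> t0; rewrite subr_ge0; exact: fmin (Qx t t0).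
have E_le s t : 0 <= s -> s <= t -> E t <= E s.
  move=> s0 st; rewrite lerB//.
  exact: (f_solution_le H_hilbert Q_convex P_proj xd xe Qx0 fg f_C1 lambda_gt0).

(* Consequences of the growth condition and of the energy inequality *)
pose w s := E s `^ theta.
have w_ge0 s : 0 <= w s by exact: powR_ge0.
have wsqr s : w s ^+ 2 = E s `^ (2 * theta).
  by rewrite -powR_mulrn ?powR_ge0// -powRrM mulrC.
have near_min s : 0 <= s ->
    exists2 z, argmin_on f Q fQ z & `|x s - z| <= 2 / kappa * w s.
  (* A minimizer almost at the distance suffices: the slack [w s / kappa] doubles the bound. It is
     positive unless [E s] is 0, and then [x s] is itself a minimizer. *)
  move=> s0; have [Es0|Es0] := eqVneq (E s) 0.
    exists (x s); first by split; [exact: Qx|apply/eqP; rewrite -subr_eq0; apply/eqP].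
    by rewrite subrr normr0 mulr_ge0 ?w_ge0// divr_ge0// ltW.
  have ws0 : 0 < w s by rewrite powR_gt0// lt_neqAle eq_sym Es0 E_ge0.
  have hi : has_inf [set `|x s - y| | y in argmin_on f Q fQ].
    split; first by exists `|x s - z0|, z0.
    by exists 0 => _ [y _ <-].
  have [_ [y Sy <-] xy] := inf_adherent (divr_gt0 ws0 kappa_gt0) hi.
  exists y => //; apply: (le_trans (ltW xy)).
  have : dist (x s) (argmin_on f Q fQ) <= w s / kappa.
    by rewrite ler_pdivlMr// mulrC; exact: f_growth (Qx s s0).
  rewrite /dist => h; apply: (le_trans (lerD h (lexx _))).
  by rewrite le_eqVlt; apply/orP; left; apply/eqP; ring.
have theta2 : 0 <= 1 - 2 * theta by move: theta_le; lra.
(* The first term comes from half the square of [2 / kappa * w s], the second from splitting [E s]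
   into powers 1 - 2 theta and 2 theta. *)
pose C := 2 / kappa ^+ 2 + lambda 0 * E 0 `^ (1 - 2 * theta).
have C_gt0 : 0 < C.
  apply: ltr_pwDl; first by rewrite divr_gt0// exprn_gt0.
  by rewrite mulr_ge0 ?powR_ge0//; exact/ltW/lambda_gt0.
have key s t : 0 <= s -> s <= t ->
    exists2 z, `|x s - z| <= 2 / kappa * w s &
      `|x t - z| ^+ 2 / 2 + E t * (G t - G s) <= C * w s ^+ 2.
  move=> s0 st; have [z [Qz fz] xz] := near_min s s0; exists z => //.
  have zmin y : Q y -> f z <= f y by rewrite fz; exact: fmin.
  have := energy_le H_hilbert Q_convex P_proj xd xe Qx0 fg f_C1 lambda_gt0 lle
    (step_size_cvg lambda_ac) (Gamma_le lambda_ac lambda'_le0) Qz zmin s0 st.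
  rewrite fz -!/(E _) -!/(G _).
  have t0 := le_trans s0 st.
  have : 0 <= lambda t * E t by rewrite mulr_ge0 ?E_ge0// ltW ?lambda_gt0.
  have : `|x s - z| ^+ 2 / 2 <= 2 / kappa ^+ 2 * w s ^+ 2.
    rewrite ler_pdivrMr// (_ : _ * 2 = (2 / kappa * w s) ^+ 2); last first.
      by field; rewrite gt_eqF.
    by rewrite ler_pXn2r ?nnegrE// mulr_ge0// divr_ge0// ltW.
  have : lambda s * E s <= lambda 0 * E 0 `^ (1 - 2 * theta) * w s ^+ 2.
    have ls0 : 0 <= lambda s by exact/ltW/lambda_gt0.
    rewrite -mulrA wsqr; apply: ler_pM; [by []|exact: E_ge0|exact: lle|].
    (* The exponents add up to 1, so this also holds when [E s] is 0, even for [theta] equal to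
       1/2. *)
    have Es : E s `^ (1 - 2 * theta) * E s `^ (2 * theta) = E s.
      by rewrite -powRD ?subrK ?oner_eq0// powRr1// E_ge0.
    by rewrite -[leLHS]Es ler_wpM2r ?powR_ge0// ge0_ler_powR ?nnegrE ?E_ge0 ?E_le.
  rewrite /C mulrDl; lra.
have EG s t : 0 <= s -> s <= t -> E t * (G t - G s) <= C * E s `^ (2 * theta).
  move=> s0 st; have [z _] := key s t s0 st.
  have : 0 <= `|x t - z| ^+ 2 by rewrite sqr_ge0.
  rewrite wsqr; lra.
(* [1 + C] bounds the square root of 2 C, for the distance from [x t] to [z]; [2 / kappa] accounts
   for the distance from [z] to [x s]. *)
pose D := 1 + C + 2 / kappa.
have D_gt0 : 0 < D by apply: addr_gt0; [exact: addr_gt0|exact: divr_gt0].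
have xD s t : 0 <= s -> s <= t -> `|x t - x s| <= D * w s.
  move=> s0 st; have [z xsz xtz] := key s t s0 st.
  have tz : `|x t - z| <= (1 + C) * w s.
    have C1 : 0 <= 1 + C by exact/ltW/addr_gt0.
    rewrite -(ler_pXn2r (ltn0Sn 1)) ?nnegrE ?(mulr_ge0 C1 (w_ge0 s))//.
    have : 0 <= E t * (G t - G s).
      apply: mulr_ge0; last by rewrite subr_ge0 G_homo.
      by apply: E_ge0; exact: le_trans st.
    have : 2 * C * w s ^+ 2 <= (1 + C) ^+ 2 * w s ^+ 2.
      by rewrite ler_wpM2r ?sqr_ge0//; move: (sqr_ge0 C); lra.
    rewrite exprMn; lra.
  have -> : x t - x s = (x t - z) + (z - x s) by rewrite addrA subrK.
  apply: (le_trans (ler_normD _ _)).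
  by rewrite (distrC z) /D mulrDl lerD.

(* Strong convergence to a minimizer once [E] takes arbitrarily small values *)
have limit : (forall e, 0 < e -> exists2 s, 0 <= s & E s <= e) ->
    exists xoo, [/\ argmin_on f Q fQ xoo, x t @[t --> +oo] --> xoo
      & forall s, 0 <= s -> `|x s - xoo| <= D * w s].
  move=> small; have [|e e0|l xl xDl] := @cvg_of_modulus R H x (fun s => D * w s).
  - exact: xD.
  - have [|s s0 Es] := small ((e / D) `^ theta^-1); first by rewrite powR_gt0 ?divr_gt0.
    exists s => //; rewrite mulrC -ler_pdivlMr//.
    have -> : e / D = ((e / D) `^ theta^-1) `^ theta.
      by rewrite -powRrM mulVf ?gt_eqF// powRr1// divr_ge0// ltW.
    by rewrite ge0_ler_powR ?nnegrE ?powR_ge0 ?E_ge0// ltW.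
  have ge (s : R) : \forall t \near +oo, s <= t by exact: nbhs_pinfty_ge (num_real s).
  have Ql : Q l.
    apply: (@closed_cvg _ _ (+oo : set_system R) _ x Q) => //.
    by have := ge 0; apply: filterS => t; exact: Qx.
  exists l; split=> //; split=> //; apply/le_anti; rewrite fmin// andbT.
  apply/ler_addgt0Pr => e e0; have [s s0 Es] := small _ e0.
  apply: (@closed_cvg _ _ (+oo : set_system R) _ (f \o x) (fun r => r <= fQ + e)).
  - exact: closed_le.
  - have := ge s; apply: filterS => t st /=.
    by have := le_trans (E_le _ _ s0 st) Es; rewrite /E; lra.
  - apply: cvg_comp xl _; apply: differentiable_continuous.
    exact: (f_grad l).1.
split.

(* The case theta < 1/2: polynomial rates *)
- move=> theta_lt hint; set alpha := theta / (1 - 2 * theta) in hint *.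
  have th1 : 0 < 1 - 2 * theta by move: theta_lt; lra.
  have alpha0 : 0 < alpha by rewrite divr_gt0.
  pose h t := G t `^ (- alpha).
  have h_ge0 t : 1 <= t -> 0 <= h t by move=> _; exact: powR_ge0.
  have h_le s t : 1 <= s -> s <= t -> h t <= h s.
    move=> s1 st; apply: le_powRN; rewrite ?(ltW alpha0) ?G_gt0 ?G_homo//; lra.
  have th21 : 2 * theta < 1 by lra.
  have th20 : 0 < 2 * theta by lra.
  have [K K0 EK] := power_decay E_ge0 E_le C_gt0 G0 G_gt0 G_ivt th20 th21 EG.
  have EKr r t : 0 <= r -> 0 < t ->
      E t `^ r <= K `^ r * G t `^ (- (r / (1 - 2 * theta))).
    move=> r0 t0; apply: (@le_trans _ _ ((K * G t `^ (- (1 - 2 * theta)^-1)) `^ r)).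
      by rewrite ge0_ler_powR ?nnegrE ?E_ge0 ?EK ?mulr_ge0 ?powR_ge0 ?(ltW K0) ?(ltW t0).
    rewrite powRM ?powR_ge0 ?(ltW K0)// -powRrM mulNr [_^-1 * r]mulrC.
    exact: lexx.
  have [e e0|xoo [Sxoo xxoo xD']] := limit.
    have eK : 0 < (e / K) `^ theta by rewrite powR_gt0 ?divr_gt0.
    have [t t1 ht] := log_integrable_small h_ge0 h_le hint eK.
    have t0 : 0 < t by lra.
    exists t; first exact: ltW.
    apply: (le_trans (EK t t0)); rewrite mulrC -ler_pdivlMr//.
    have -> : e / K = ((e / K) `^ theta) `^ theta^-1.
      by rewrite -powRrM mulfV ?gt_eqF// powRr1// divr_ge0// ltW.
    have -> : G t `^ (- (1 - 2 * theta)^-1) = h t `^ theta^-1.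
      by rewrite /h -powRrM; congr (_ `^ _); rewrite /alpha; field; rewrite !gt_eqF.
    by rewrite ge0_ler_powR ?nnegrE ?invr_ge0 ?(ltW theta_gt0) ?(ltW ht) ?powR_ge0.
  exists xoo; split=> //.
  + apply/eqO_exP; exists (D * K `^ theta * (2 * 2 `^ alpha)).
      by rewrite !mulr_gt0 ?powR_gt0.
    have := nbhs_pinfty_ge (num_real (1 : R)); apply: filterS => t t1.
    have t0 : 0 < t by lra.
    rewrite normr_id; apply: (le_trans (xD' t (ltW t0))).
    rewrite -!mulrA ler_pM2l//; apply: (le_trans (EKr _ _ (ltW theta_gt0) t0)).
    rewrite ler_pM2l ?powR_gt0// mulrA.
    apply: (@le_trans _ _ (2 * 2 `^ alpha * (h (2 * t) / 2))); last first.
      rewrite ler_pM2l ?mulr_gt0 ?powR_gt0//.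
      exact: le_trans (log_integrable_tail h_ge0 h_le hint t1) (ler_norm _).
    rewrite (_ : 2 * _ * _ = 2 `^ alpha * h (2 * t)); last by field.
    have G2 : G (2 * t) <= 2 * G t.
      have t20 : 0 <= 2 * t by lra.
      have := G_half _ t20; rewrite (_ : 2 * t / 2 = t); last by field.
      lra.
    have : (2 * G t) `^ (- alpha) <= h (2 * t).
      apply: le_powRN => //; last exact: ltW.
      by apply: G_gt0; lra.
    rewrite powRM ?(ltW (G_gt0 _ t0))// powRN => h2.
    by rewrite -ler_pdivrMl ?powR_gt0//.
  + pose gamma := 2 * theta / (1 - 2 * theta).
    have gamma0 : 0 < gamma by rewrite divr_gt0.
    (* The decay inequality is used between t/2 and t: [G t - G (t / 2)] is at least t lambda(t) /
       2, whence the factor 2, and [G (t / 2) >= G t / 2] yields the power of 1/2. *)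
    apply/eqO_exP; exists (2 * (C * (K `^ (2 * theta) * 2^-1 `^ (- gamma)))).
      by rewrite !mulr_gt0 ?powR_gt0.
    have := nbhs_pinfty_ge (num_real (1 : R)); apply: filterS => t t1.
    have t0 : 0 < t by lra.
    have l0 : 0 < lambda t by apply: lambda_gt0; exact: ltW.
    rewrite -/(E t) (ger0_norm (E_ge0 t (ltW t0))).
    rewrite ger0_norm ?divr_ge0 ?powR_ge0 ?mulr_ge0 ?(ltW t0) ?(ltW l0)//.
    rewrite [leRHS]mulrA ler_pdivlMr ?mulr_gt0// -/gamma -/(G t).
    have t20 : 0 < t / 2 by rewrite divr_gt0.
    have t2t : t / 2 <= t by lra.
    have h1 : lambda t * (t - t / 2) <= G t - G (t / 2).
      exact: (Gamma_ge lambda_ac lambda'_le0 (ltW t20) t2t).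
    have h2 := EG _ _ (ltW t20) t2t.
    have h3 := EKr _ _ (ltW th20) t20; rewrite -/gamma in h3.
    have h4 : G (t / 2) `^ (- gamma) <= 2^-1 `^ (- gamma) * G t `^ (- gamma).
      rewrite -powRM ?invr_ge0 ?(ltW (G_gt0 _ t0))//.
      apply: le_powRN; rewrite ?mulr_gt0 ?G_gt0 ?(ltW gamma0)//.
      by rewrite mulrC; exact: G_half (ltW t0).
    have h5 : E t * (lambda t * (t - t / 2)) <= E t * (G t - G (t / 2)).
      by rewrite ler_wpM2l// E_ge0// ltW.
    have h6 : E (t / 2) `^ (2 * theta) <=
        K `^ (2 * theta) * (2^-1 `^ (- gamma) * G t `^ (- gamma)).
      by apply: (le_trans h3); rewrite ler_pM2l ?powR_gt0.
    have h7 : C * E (t / 2) `^ (2 * theta) <=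
        C * (K `^ (2 * theta) * (2^-1 `^ (- gamma) * G t `^ (- gamma))).
      by rewrite ler_pM2l.
    move: (le_trans h5 (le_trans h2 h7)); lra.

(* The case theta = 1/2: exponential rates *)
- move=> thetaE hint.
  have th2 : 2 * theta = 1 by rewrite thetaE; field.
  have EG1 s t : 0 <= s -> s <= t -> E t * (G t - G s) <= C * E s.
    by move=> s0 st; have := EG s t s0 st; rewrite th2 powRr1// E_ge0.
  have [K [mu [K0 mu0 EK]]] := exponential_decay E_ge0 E_le C_gt0 G_ivt EG1.
  pose h t := expR (- 1 * G t).
  have h_le0 s t : 0 <= s -> s <= t -> h t <= h s.
    by move=> s0 st; rewrite ler_expR !mulN1r lerN2 G_homo.
  have h_le s t : 1 <= s -> s <= t -> h t <= h s.
    by move=> s1; apply: h_le0; lra.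
  have h_ge0 t : 1 <= t -> 0 <= h t by move=> _; exact: expR_ge0.
  have hint1 : (\int[@lebesgue_measure R]_(t in `[1%R, +oo[)
      ((1 + t)^-1 * h t)%:E < +oo)%E.
    have mh : measurable_fun `[(0 : R), +oo[ (fun t => (1 + t)^-1 * h t).
      apply: nonincreasing_measurable_itvcy => s t s0 st.
      by apply: ler_pM; rewrite ?invr_ge0 ?expR_ge0 ?h_le0 ?lef_pV2 ?posrE//; lra.
    apply: le_lt_trans (hint 1 ltr01); apply: ge0_subset_integral => //.
    - exact/measurable_EFinP.
    - move=> t /=; rewrite in_itv/= andbT lee_fin => t0.
      by rewrite mulr_ge0 ?invr_ge0 ?expR_ge0// addr_ge0.
    - by apply: subset_itvr; rewrite bnd_simp.
  have [e e0|xoo [Sxoo xxoo xD']] := limit.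
    have eK : 0 < (e / K) `^ mu^-1 by rewrite powR_gt0 ?divr_gt0.
    have [t t1 ht] := log_integrable_small h_ge0 h_le hint1 eK.
    have t0 : 0 <= t by lra.
    exists t => //; apply: (le_trans (EK t t0)); rewrite mulrC -ler_pdivlMr//.
    have -> : e / K = ((e / K) `^ mu^-1) `^ mu.
      by rewrite -powRrM mulVf ?gt_eqF// powRr1// divr_ge0// ltW.
    have -> : expR (- mu * G t) = h t `^ mu.
      by rewrite -expRM; congr expR; ring.
    by rewrite ge0_ler_powR ?nnegrE ?powR_ge0 ?expR_ge0 ?(ltW mu0) ?(ltW ht).
  (* The distance is controlled by the square root of [E], which halves the rate; the gap decays at
     rate [mu], hence also at [mu / 2]. *)
  exists xoo; split=> //; exists (mu / 2); split.
  + by rewrite divr_gt0.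
  + apply/eqO_exP; exists (D * K `^ theta); first by rewrite mulr_gt0 ?powR_gt0.
    have := nbhs_pinfty_ge (num_real (0 : R)); apply: filterS => t t0.
    rewrite normr_id ger0_norm ?expR_ge0//; apply: (le_trans (xD' t t0)).
    rewrite -mulrA ler_pM2l//.
    apply: (@le_trans _ _ ((K * expR (- mu * G t)) `^ theta)).
      rewrite ge0_ler_powR ?nnegrE ?E_ge0 ?EK ?(ltW theta_gt0)//.
      by rewrite mulr_ge0 ?expR_ge0 ?(ltW K0).
    rewrite powRM ?expR_ge0 ?(ltW K0)// ler_pM2l ?powR_gt0// -expRM ler_expR.
    by rewrite thetaE -/(G t); lra.
  + apply/eqO_exP; exists K => //.
    have := nbhs_pinfty_ge (num_real (0 : R)); apply: filterS => t t0.
    rewrite -/(E t) ger0_norm ?E_ge0// ger0_norm ?expR_ge0//.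
    apply: (le_trans (EK t t0)); rewrite ler_pM2l// ler_expR -/(G t).
    have : 0 <= mu * G t by rewrite mulr_ge0 ?(ltW mu0)// -G0 G_homo.
    lra.
Qed.
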